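(* Let $q\in\Bbbk^\ast$ be not a root of unity, and let $\sigma$ be a fixed automorphism of $\Bbbk_q[x,y]$ given by $\sigma(x)=\alpha x$, $\sigma(y)=\beta y$ with $\alpha,\beta\in\Bbbk^\ast$. Then the class of isotropy groups of $\sigma$-derivations of $\Bbbk_q[x,y]$ includes, up to isomorphism, all finite subgroups of $\mathrm{Aut}(\Bbbk_q[x,y])$; that is, for every finite subgroup $H$ of $\mathrm{Aut}(\Bbbk_q[x,y])$ there is a $\sigma$-derivation $\delta$ of $\Bbbk_q[x,y]$ with $\mathrm{Aut}_\delta(\Bbbk_q[x,y])\cong H$.
   Context: $\Bbbk$ is an algebraically closed field of characteristic zero. The quantum plane $\Bbbk_q[x,y]$ is the $\Bbbk$-algebra generated by $x,y$ with the relation $xy=qyx$. For $q\neq\pm1$ every automorphism has the form $\rho(x)=\mu_1x$, $\rho(y)=\mu_2y$ with $\mu_1,\mu_2\in\Bbbk^\ast$, so $\mathrm{Aut}(\Bbbk_q[x,y])\cong\Bbbk^\ast\times\Bbbk^\ast$. For an automorphism $\sigma$ of an algebra $A$, a $\sigma$-derivation is a $\Bbbk$-linear map $\delta:A\to A$ with $\delta(ab)=\delta(a)\sigma(b)+a\delta(b)$ for all $a,b\in A$. Its isotropy group is $\mathrm{Aut}_\delta(A)=\{\rho\in\mathrm{Aut}(A):\rho\sigma=\sigma\rho,\ \rho\delta=\delta\rho\}$. *)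

(* Defs.v *)
From HB Require Import structures.
From mathcomp Require Import all_boot all_algebra generic_quotient ring_quotient.
From mathcomp Require Import finmap monalg.
From mathcomp Require Import boolp classical_sets functions cardinality.

Set Implicit Arguments.
Unset Strict Implicit.
Unset Printing Implicit Defensive.

Import GRing.Theory.
Local Open Scope ring_scope.
Local Open Scope quotient_scope.
Local Open Scope classical_set_scope.

(* The quantum plane is built as k<X, Y> / (XY - q YX), where k<X, Y> is the
   monoid algebra of the free monoid on the two letters 0 and 1 of 'I_2. *)
Section QuantumPlane.
Variables (k : fieldType) (q : k).

Local Notation free2 := {malg k[{fmonom 'I_2}]}.

Definition freeX : free2 := mkmalgU (fmu (0 : 'I_2)) 1.
Definition freeY : free2 := mkmalgU (fmu (1 : 'I_2)) 1.

Definition qrel : free2 := freeX * freeY - q *: (freeY * freeX).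

(* The two-sided ideal generated by qrel. *)
Definition qideal : {pred free2} := fun p =>
  `[< exists s : seq (free2 * free2), p = \sum_(ab <- s) ab.1 * qrel * ab.2 >].

Fact qideal_zmod : zmod_closed qideal.
Proof.
split=> [|u v]; first by apply/asboolP; exists [::]; rewrite big_nil.
move=> /asboolP[s ->] /asboolP[t ->]; apply/asboolP.
exists (s ++ [seq (- ab.1, ab.2) | ab <- t]); rewrite big_cat big_map /=.
by congr (_ + _); rewrite -sumrN; apply: eq_bigr => ab _; rewrite !mulNr.
Qed.

HB.instance Definition _ := GRing.isZmodClosed.Build free2 qideal qideal_zmod.

Fact qidealMl a p : p \in qideal -> a * p \in qideal.
Proof.
move=> /asboolP[s ->]; apply/asboolP.
exists [seq (a * ab.1, ab.2) | ab <- s]; rewrite big_map mulr_sumr.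
by apply: eq_bigr => ab _; rewrite /= !mulrA.
Qed.

Fact qidealMr a p : p \in qideal -> p * a \in qideal.
Proof.
move=> /asboolP[s ->]; apply/asboolP.
exists [seq (ab.1, ab.2 * a) | ab <- s]; rewrite big_map mulr_suml.
by apply: eq_bigr => ab _; rewrite /= !mulrA.
Qed.

Fact qideal1 : 1 \notin qideal.
Proof.
apply/asboolPn => -[s /(congr1 (@mcoeff {fmonom 'I_2} k mone))].
rewrite rmorph1 rmorph_sum big1 /=; first by move/eqP; rewrite oner_eq0.
move=> ab _.
have X0 : mcoeff mone freeX = 0 by rewrite /freeX mcoeffU fmP /fmu fmE fm1.
rewrite !rmorphM /= rmorphB /= mcoeffZ !rmorphM /= X0.
by rewrite !(mul0r, mulr0, subr0).
Qed.

Fact free2_scalerAr (c : k) (u v : free2) : c *: (u * v) = u * (c *: v).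
Proof.
rewrite -[c *: v]mul_malgC [in RHS]mulrA [in LHS]scalerAl; congr (_ * v).
rewrite malgM_def fgmulgU malgZ_def.
by apply: eq_bigr => m _; rewrite mulrC mulm1.
Qed.

Definition qplane := Quotient.quot qideal.

HB.instance Definition _ := GRing.Zmodule.on qplane.

Local Notation pi := (\pi_qplane : free2 -> qplane).

Fact qplane_eq u v : (pi u == pi v) = (u - v \in qideal).
Proof. by rewrite Quotient.idealrBE. Qed.

Definition qone : qplane := lift_cst qplane 1.
Definition qmul : qplane -> qplane -> qplane := lift_op2 qplane *%R.
Definition qscale (c : k) : qplane -> qplane := lift_op1 qplane ( *:%R c).

Fact pi_qone : pi 1 = qone.
Proof. by rewrite /qone; unlock. Qed.

Fact pi_qmul u v : pi (u * v) = qmul (pi u) (pi v).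
Proof.
unlock qmul; apply/eqP; rewrite qplane_eq.
set u' := repr _; set v' := repr _.
have -> : u * v - u' * v' = u * (v - v') + (u - u') * v'.
  by rewrite mulrBr mulrBl addrA subrK.
by apply: rpredD; [apply: qidealMl|apply: qidealMr]; rewrite -qplane_eq reprK.
Qed.

Fact pi_qscale c u : pi (c *: u) = qscale c (pi u).
Proof.
unlock qscale; apply/eqP; rewrite qplane_eq -scalerBr -mul_malgC.
by apply: qidealMl; rewrite -qplane_eq reprK.
Qed.

Fact pi_qadd u v : pi (u + v) = pi u + pi v.
Proof. exact: raddfD. Qed.

Fact qplaneP (x : qplane) : exists u, x = pi u.
Proof. by exists (repr x); rewrite reprK. Qed.

Fact qmulA : associative qmul.
Proof.
move=> x y z; have [[[u ->] [v ->]] [w ->]] := (qplaneP x, qplaneP y, qplaneP z).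
by rewrite -!pi_qmul mulrA.
Qed.

Fact qmul1x : left_id qone qmul.
Proof. by move=> x; have [u ->] := qplaneP x; rewrite -pi_qone -pi_qmul mul1r. Qed.

Fact qmulx1 : right_id qone qmul.
Proof. by move=> x; have [u ->] := qplaneP x; rewrite -pi_qone -pi_qmul mulr1. Qed.

Fact qmulDl : left_distributive qmul +%R.
Proof.
move=> x y z; have [[[u ->] [v ->]] [w ->]] := (qplaneP x, qplaneP y, qplaneP z).
by rewrite -pi_qadd -!pi_qmul -pi_qadd mulrDl.
Qed.

Fact qmulDr : right_distributive qmul +%R.
Proof.
move=> x y z; have [[[u ->] [v ->]] [w ->]] := (qplaneP x, qplaneP y, qplaneP z).
by rewrite -pi_qadd -!pi_qmul -pi_qadd mulrDr.
Qed.

Fact qone_neq0 : qone != 0.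
Proof.
by rewrite -pi_qone -[0](raddf0 \pi_qplane) qplane_eq subr0 qideal1.
Qed.

HB.instance Definition _ := GRing.Zmodule_isNzRing.Build qplane
  qmulA qmul1x qmulx1 qmulDl qmulDr qone_neq0.

Fact qscaleA a b x : qscale a (qscale b x) = qscale (a * b) x.
Proof. by have [u ->] := qplaneP x; rewrite -!pi_qscale scalerA. Qed.

Fact qscale1 : left_id 1 qscale.
Proof. by move=> x; have [u ->] := qplaneP x; rewrite -pi_qscale scale1r. Qed.

Fact qscaleDr : right_distributive qscale +%R.
Proof.
move=> c x y; have [[u ->] [v ->]] := (qplaneP x, qplaneP y).
by rewrite -pi_qadd -!pi_qscale -pi_qadd scalerDr.
Qed.

Fact qscaleDl x : {morph qscale^~ x : a b / a + b}.
Proof.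
by move=> a b; have [u ->] := qplaneP x; rewrite -!pi_qscale -pi_qadd scalerDl.
Qed.

HB.instance Definition _ := GRing.Zmodule_isLmodule.Build k qplane
  qscaleA qscale1 qscaleDr qscaleDl.

Fact qscaleAl (c : k) (x y : qplane) : c *: (x * y) = c *: x * y.
Proof.
have [[u ->] [v ->]] := (qplaneP x, qplaneP y).
rewrite -[_ * pi v]pi_qmul -[LHS]pi_qscale -[c *: pi u]pi_qscale.
by rewrite -[RHS]pi_qmul scalerAl.
Qed.

HB.instance Definition _ := GRing.Lmodule_isLalgebra.Build k qplane qscaleAl.

Fact qscaleAr (c : k) (x y : qplane) : c *: (x * y) = x * (c *: y).
Proof.
have [[u ->] [v ->]] := (qplaneP x, qplaneP y).
rewrite -[pi u * pi v]pi_qmul -[LHS]pi_qscale -[c *: pi v]pi_qscale.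
by rewrite -[RHS]pi_qmul free2_scalerAr.
Qed.

HB.instance Definition _ := GRing.Lalgebra_isAlgebra.Build k qplane qscaleAr.

Definition qx : qplane := pi freeX.
Definition qy : qplane := pi freeY.

Fact qx_qy : qx * qy = q *: (qy * qx).
Proof.
rewrite -[qx * qy]pi_qmul -[qy * qx]pi_qmul -[RHS]pi_qscale; apply/eqP.
rewrite qplane_eq; apply/asboolP; exists [:: (1, 1)].
by rewrite big_seq1 /= mul1r mulr1.
Qed.

End QuantumPlane.

Section AlgebraAutomorphisms.
Variables (k : fieldType) (A : algType k).

Record alg_aut := AlgAut {
  alg_aut_fun :> A -> A;
  alg_aut_linear : linear alg_aut_fun;
  alg_aut_monoid : monoid_morphism alg_aut_fun;
  alg_aut_bij : bijective alg_aut_fun }.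

Fact alg_autP (f g : alg_aut) : f =1 g -> f = g.
Proof.
case: f g => [f lf mf bf] [g lg mg bg] /= /funext fg.
case: _ / fg in lg mg bg *.
by congr AlgAut; apply: Prop_irrelevance.
Qed.

Definition alg_aut_one : alg_aut := @AlgAut id (fun _ _ _ => erefl)
  (erefl, fun _ _ => erefl) (Bijective (frefl _) (frefl _)).

Fact alg_aut_comp_linear (f g : alg_aut) : linear (f \o g).
Proof. by move=> c x y /=; rewrite !alg_aut_linear. Qed.

Fact alg_aut_comp_monoid (f g : alg_aut) : monoid_morphism (f \o g).
Proof. by split=> [|x y] /=; rewrite !alg_aut_monoid. Qed.

Definition alg_aut_mul (f g : alg_aut) : alg_aut :=
  AlgAut (alg_aut_comp_linear f g) (alg_aut_comp_monoid f g)
         (bij_comp (alg_aut_bij f) (alg_aut_bij g)).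

Fact alg_aut_has_inv (f : alg_aut) :
  exists g : alg_aut, cancel g f /\ cancel f g.
Proof.
have [g fK gK] := alg_aut_bij f.
have lg : linear g by move=> c x y; apply: (can_inj fK); rewrite alg_aut_linear !gK.
have mg : monoid_morphism g.
  by split=> [|x y]; apply: (can_inj fK); rewrite alg_aut_monoid !gK.
by exists (AlgAut lg mg (Bijective gK fK)).
Qed.

Definition alg_aut_inv (f : alg_aut) : alg_aut := sval (cid (alg_aut_has_inv f)).

Fact alg_aut_invK (f : alg_aut) : cancel (alg_aut_inv f) f.
Proof. by rewrite /alg_aut_inv; case: cid => g []. Qed.

Fact alg_autK (f : alg_aut) : cancel f (alg_aut_inv f).
Proof. by rewrite /alg_aut_inv; case: cid => g []. Qed.

HB.instance Definition _ := gen_eqMixin alg_aut.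
HB.instance Definition _ := gen_choiceMixin alg_aut.

Fact alg_aut_mulA : associative alg_aut_mul.
Proof. by move=> f g h; apply: alg_autP. Qed.

Fact alg_aut_mul1 : left_id alg_aut_one alg_aut_mul.
Proof. by move=> f; apply: alg_autP. Qed.

Fact alg_aut_mulr1 : right_id alg_aut_one alg_aut_mul.
Proof. by move=> f; apply: alg_autP. Qed.

Fact alg_aut_mulV : left_inverse alg_aut_one alg_aut_inv alg_aut_mul.
Proof. by move=> f; apply: alg_autP => x; apply: alg_autK. Qed.

Fact alg_aut_mulrV : right_inverse alg_aut_one alg_aut_inv alg_aut_mul.
Proof. by move=> f; apply: alg_autP => x; apply: alg_aut_invK. Qed.

(* The product f * g in Aut(A) is the composite f \o g. *)
HB.instance Definition _ := isGroup.Build alg_aut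
  alg_aut_mulA alg_aut_mul1 alg_aut_mulr1 alg_aut_mulV alg_aut_mulrV.

Definition sigma_derivation (sigma : alg_aut) (delta : A -> A) : Prop :=
  linear delta /\
  forall a b, delta (a * b) = delta a * sigma b + a * delta b.

Definition isotropy (sigma : alg_aut) (delta : A -> A) : set alg_aut :=
  [set rho : alg_aut |
    rho \o sigma = sigma \o rho /\ rho \o delta = delta \o rho].

End AlgebraAutomorphisms.

Definition is_subgroup (G : groupType) (H : set G) : Prop :=
  [/\ H 1%g, forall g h, H g -> H h -> H (g * h)%g & forall g, H g -> H g^-1%g].

Definition subgroups_isog (G1 G2 : groupType) (H1 : set G1) (H2 : set G2) :
    Prop :=
  exists f : G1 -> G2,
    set_bij H1 H2 f /\ forall g h, H1 g -> H1 h -> f (g * h)%g = (f g * f h)%g.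

Lemma isotropy_subgroup (k : fieldType) (A : algType k) (sigma : alg_aut A)
    (delta : A -> A) : is_subgroup (isotropy sigma delta).
Proof.
split=> [|f g [fs fd] [gs gd]|f [fs fd]]; split=> //; apply/funext => x /=.
- by have /= := congr1 (@^~ (g x)) fs; have /= -> := congr1 (@^~ x) gs.
- by have /= := congr1 (@^~ (g x)) fd; have /= -> := congr1 (@^~ x) gd.
- apply: (can_inj (alg_autK f)) => /=.
  have /= -> := congr1 (@^~ (alg_aut_inv f x)) fs.
  by rewrite !alg_aut_invK.
- apply: (can_inj (alg_autK f)) => /=.
  have /= -> := congr1 (@^~ (alg_aut_inv f x)) fd.
  by rewrite !alg_aut_invK.
Qed.

(* Main.v *)
From HB Require Import structures.
Require Import Defs.
From mathcomp Require Import all_boot all_algebra ring_quotient generic_quotient.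
From mathcomp Require Import finmap monalg ring.
From mathcomp Require Import boolp classical_sets functions cardinality.

Set Implicit Arguments.
Unset Strict Implicit.
Unset Printing Implicit Defensive.

Import GRing.Theory.
Local Open Scope ring_scope.
Local Open Scope quotient_scope.

(** Inner skew derivations already realize every finite group.  For [w] in the
    quantum plane, [a |-> w * sigma a - a * w] is a [sigma]-derivation, and an
    automorphism [f] commuting with [sigma] commutes with it if and only if
    [u = f w - w] satisfies [u * sigma a = a * u] for all [a]
    ([inner_isotropyP]).  Every automorphism is diagonal
    ([qplane_aut_diag]): it commutes with [sigma], and it multiplies
    [x ^+ i * y ^+ j] by the value of a character of the automorphism group.
    Since [x ^+ i * y ^+ j * x = q ^- j *: (x ^+ i.+1 * y ^+ j)], the equation
    [u * sigma x = x * u] allows a monomial [x ^+ i * y ^+ j] in [u] only when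
    [alpha = q ^+ j], which happens for at most one [j] because [q] is not a
    root of unity.  So, if [w] is a sum of monomials of large degree in [y],
    its isotropy group consists of the [f] that fix each of these monomials.

    Let [n] be the order of the finite group [H], and [M] a large multiple of
    [n].  Take for [w] the sum of the [x ^+ (M + i) * y ^+ (M + j)] with
    [i, j <= n] such that the character of [x ^+ i * y ^+ j] is trivial on [H].
    The shift by [M] does not change a character on [H], because values of
    characters on [H] are [n]-th roots of unity; so [H] fixes [w].  Conversely
    the chosen characters cut out exactly [H], by an orthogonality argument
    with sums of roots of unity ([mem_of_trivial_characters]).  The isotropy
    group is thus equal to [H], not only isomorphic to it
    ([isotropy_inner_eq]).

    Two facts on the quantum plane support this.  The monomials
    [x ^+ i * y ^+ j] are a basis: putting words in normal order, with one
    factor [q^-1] for each exchange, is multiplicative for a twisted product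
    [tmul] on polynomials in two variables, so it kills the defining relation
    ([free_nf_ideal]) and gives coordinates ([nfK], [nf_mono]).  The
    degree in [y] is additive for [tmul], so the quantum plane is a domain whose
    units are scalars.  As for the automorphisms, the quotients by [x] and by [y]
    are commutative domains, and each must kill [f x] or [f y], because
    [f x * f y = q *: (f y * f x)] with [q != 1].  Comparing with the inverse of
    [f] leaves only the diagonal maps and the exchange of the two axes, and the
    exchange would force [q ^+ 2 = 1]. *)

(** * Finite groups cut out by characters *)

Lemma mem_mul_perm (G : groupType) (s : seq G) g :
  uniq s -> (forall h, h \in s -> (g * h)%g \in s) ->
  perm_eq [seq (g * h)%g | h <- s] s.
Proof.
move=> us gs; have ugs : uniq [seq (g * h)%g | h <- s].
  by rewrite map_inj_uniq //; apply: mulgI.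
have sub : {subset [seq (g * h)%g | h <- s] <= s}.
  by move=> _ /mapP[h hs ->]; apply: gs.
apply: uniq_perm => //.
by have [] := uniq_min_size ugs sub (eq_leq (esym (size_map _ _))).
Qed.

Lemma sum_unity_root (k : fieldType) (z : k) n :
  z ^+ n = 1 -> \sum_(i < n) z ^+ i = if z == 1 then n%:R else 0.
Proof.
case: eqP => [-> _|/eqP z1 zn].
  by under eq_bigr do rewrite expr1n; rewrite sumr_const card_ord.
apply: (mulfI (x := z - 1)); first by rewrite subr_eq0.
by rewrite -subrX1 zn subrr mulr0.
Qed.

Section Characters.
Variables (k : fieldType) (G : groupType).
Implicit Types (chi : G -> k) (s : seq G).

Definition is_character chi :=
  [/\ forall g h, chi (g * h)%g = chi g * chi h & forall g, chi g != 0].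

Lemma character1 chi : is_character chi -> chi 1%g = 1.
Proof.
by case=> chiM chi0; apply: (mulfI (chi0 1%g)); rewrite -chiM mulg1 mulr1.
Qed.

Lemma characterXM chi1 chi2 i j : is_character chi1 -> is_character chi2 ->
  is_character (fun g => chi1 g ^+ i * chi2 g ^+ j).
Proof.
move=> [M1 n1] [M2 n2]; split=> [g h|g]; last by rewrite mulf_neq0 ?expf_neq0.
by rewrite M1 M2 !exprMn mulrACA.
Qed.

(** Lagrange: translation by [g] permutes [s], so the product of the values of
    [chi] on [s] is multiplied by [chi g ^+ size s] while staying the same. *)
Lemma character_expn_size chi s g : is_character chi -> uniq s ->
  (forall g h, g \in s -> h \in s -> (g * h)%g \in s) -> g \in s ->
  chi g ^+ size s = 1.
Proof.
move=> [chiM chi0] us sM gs.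
have p0 : \prod_(h <- s) chi h != 0 by rewrite prodf_seq_neq0; apply/allP=> h _ /=.
apply: (mulIf p0); rewrite mul1r -[RHS](perm_big _ (mem_mul_perm us (sM g ^~ gs))).
rewrite big_map; under [RHS]eq_bigr do rewrite chiM.
by rewrite big_split big_const_seq count_predT iter_mulr_1.
Qed.

(** Translation by [g] permutes [s] and multiplies the sum by [chi g != 1]. *)
Lemma character_sum0 chi s g : is_character chi -> uniq s ->
  (forall g h, g \in s -> h \in s -> (g * h)%g \in s) -> g \in s ->
  chi g != 1 -> \sum_(h <- s) chi h = 0.
Proof.
move=> [chiM _] us sM gs g1; apply/eqP.
have: (chi g - 1) * (\sum_(h <- s) chi h) = 0.
  rewrite mulrBl mul1r -[X in _ - X](perm_big _ (mem_mul_perm us (sM g ^~ gs))).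
  by rewrite big_map mulr_sumr -sumrB big1 // => h _; rewrite chiM subrr.
by move/eqP; rewrite mulf_eq0 subr_eq0 (negPf g1).
Qed.

(** Let [n = size s].  The sum [D p] below of all [chi1 ^+ i * chi2 ^+ j], with
    [i, j < n], over the coset [p * s], computed in two ways.  Summing over
    [i, j] first gives geometric series that count the [h] in [s] with
    [p * h = 1], each with weight [n * n].  Summing over [h] first leaves only
    the characters trivial on [s], which are trivial at [p] too, so that
    [D p = D 1 = n * n].  This is nonzero, so [p * h = 1] for some [h]. *)
Lemma mem_of_trivial_characters chi1 chi2 s p : [pchar k] =i pred0 ->
  is_character chi1 -> is_character chi2 ->
  (forall g, chi1 g = 1 -> chi2 g = 1 -> g = 1%g) ->
  uniq s -> 1%g \in s ->
  (forall g h, g \in s -> h \in s -> (g * h)%g \in s) ->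
  (forall g, g \in s -> g^-1%g \in s) ->
  (forall i j, (i <= size s)%N -> (j <= size s)%N ->
     (forall h, h \in s -> chi1 h ^+ i * chi2 h ^+ j = 1) ->
     chi1 p ^+ i * chi2 p ^+ j = 1) ->
  p \in s.
Proof.
move=> /pcharf0P k0 c1 c2 faith us s1 sM sV; set n := size s => pL.
(* [chi1 ^+ n] and [chi2 ^+ n] are trivial on [s], hence at [p]. *)
have p1 : chi1 p ^+ n = 1.
  have := pL n 0 (leqnn _) (leq0n _); rewrite !expr0 !mulr1; apply=> //= h hs.
  by rewrite expr0 mulr1 (character_expn_size c1).
have p2 : chi2 p ^+ n = 1.
  have := pL 0 n (leq0n _) (leqnn _); rewrite !expr0 !mul1r; apply=> h hs.
  by rewrite expr0 mul1r (character_expn_size c2).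
pose D g := \sum_(h <- s) \sum_(i < n) \sum_(j < n)
  chi1 (g * h)%g ^+ i * chi2 (g * h)%g ^+ j.
have DE g : chi1 g ^+ n = 1 -> chi2 g ^+ n = 1 ->
    D g = \sum_(h <- s) (if (g * h)%g == 1%g then (n * n)%:R else 0).
  move=> g1 g2; apply: eq_big_seq => h hs.
  have gn1 : chi1 (g * h)%g ^+ n = 1.
    by rewrite c1.1 exprMn g1 (character_expn_size c1) // mulr1.
  have gn2 : chi2 (g * h)%g ^+ n = 1.
    by rewrite c2.1 exprMn g2 (character_expn_size c2) // mulr1.
  under eq_bigr do rewrite -mulr_sumr (sum_unity_root gn2).
  rewrite -mulr_suml (sum_unity_root gn1).
  case: (eqVneq (g * h)%g 1%g) => [->|gh].
    by rewrite !character1 // !eqxx natrM.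
  case: eqP => e1; last by rewrite mul0r.
  case: eqP => e2; last by rewrite mulr0.
  by rewrite (faith _ e1 e2) eqxx in gh.
have Dp : D p = D 1%g.
  rewrite /D exchange_big [RHS]exchange_big; apply: eq_bigr => i _ /=.
  rewrite exchange_big [RHS]exchange_big; apply: eq_bigr => j _ /=.
  have cc := characterXM i j c1 c2.
  have [/allP L|] := boolP (all (fun h => chi1 h ^+ i * chi2 h ^+ j == 1) s).
    have pij : chi1 p ^+ i * chi2 p ^+ j = 1.
      by apply: pL (ltnW (ltn_ord i)) (ltnW (ltn_ord j)) _ => g /L /eqP.
    apply: eq_bigr => h _; rewrite !cc.1 pij.
    by rewrite (character1 c1) (character1 c2) !expr1n !mul1r.
  case/allPn=> g gs g1.
  under eq_bigr do rewrite cc.1; under [RHS]eq_bigr do rewrite cc.1.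
  by rewrite -!mulr_sumr (character_sum0 cc us sM gs g1) !mulr0.
have n0 : (0 < n)%N by rewrite /n; case: (s) s1.
have D1 : D 1%g = (n * n)%:R.
  rewrite DE ?(character1 c1) ?(character1 c2) ?expr1n //.
  under eq_bigr do rewrite mul1g.
  by rewrite -big_mkcond -big_filter filter_pred1_uniq // big_seq1.
have [/hasP[h hs /eqP ph]|/hasPn no] := boolP (has (fun h => p * h == 1)%g s).
  by rewrite -(mulgK h p) ph mul1g sV.
move: D1; rewrite -Dp DE // big1_seq; last first.
  by move=> h /= /no /negPf ->.
move/eqP; rewrite eq_sym k0 muln_eq0 !eqn0Ngt n0 //.
Qed.
End Characters.

(** * A twisted product on polynomials in two variables *)

Section TwistedProduct.
Variables (k : fieldType) (r : k).
Implicit Types (P Q : {poly {poly k}}).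

(** The effect on a polynomial in [x] of moving a power of [y] across it:
    [y ^+ m * p(x) = p(q ^- m * x) * y ^+ m]. *)
Definition rescale (c : k) : {poly k} -> {poly k} := comp_poly (c *: 'X).

Lemma rescale_mono c d n : rescale c (d *: 'X^n) = (d * c ^+ n) *: 'X^n.
Proof. by rewrite /rescale comp_polyZ rmorphXn /= comp_polyX exprZn scalerA. Qed.

Lemma rescale_eq0 c p : c != 0 -> (rescale c p == 0) = (p == 0).
Proof.
move=> c0; rewrite -!size_poly_eq0 size_comp_poly2 //.
by rewrite size_scale ?size_polyX.
Qed.

Lemma horner0_rescale c p : (rescale c p).[0] = p.[0].
Proof. by rewrite /rescale horner_comp hornerZ hornerX mulr0. Qed.

(** The inner variable stands for [x] and the outer one for [y]; with
    [r = q^-1] this is the product of the quantum plane on elements written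
    with the powers of [y] on the right.  The size bound only serves to make
    the sequence of coefficients finite; [coef_tmul] holds at all indices. *)
Definition tmul P Q : {poly {poly k}} := \poly_(n < size P + size Q)
  \sum_(i < n.+1) P`_i * rescale (r ^+ i) Q`_(n - i).

Lemma coef_tmul P Q n :
  (tmul P Q)`_n = \sum_(i < n.+1) P`_i * rescale (r ^+ i) Q`_(n - i).
Proof.
rewrite coef_poly; case: ltnP => // le_n; symmetry; apply: big1 => i _.
have [lt_i|le_i] := ltnP i (size P); last by rewrite (nth_default _ le_i) mul0r.
rewrite (@nth_default _ _ Q) ?[rescale _ _]raddf0 ?mulr0 //.
rewrite -(leq_add2l i) subnKC ?leq_ord //.
by apply: leq_trans le_n; rewrite leq_add2r ltnW.
Qed.

Lemma tmulDl Q : {morph tmul^~ Q : P P' / P + P'}.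
Proof.
move=> P P'; apply/polyP=> n; rewrite coefD !coef_tmul -big_split /=.
by apply: eq_bigr => i _; rewrite coefD mulrDl.
Qed.

Lemma tmulDr P : {morph tmul P : Q Q' / Q + Q'}.
Proof.
move=> Q Q'; apply/polyP=> n; rewrite coefD !coef_tmul -big_split /=.
by apply: eq_bigr => i _; rewrite coefD [rescale _ _]raddfD mulrDr.
Qed.

Lemma tmul0 P : tmul P 0 = 0.
Proof.
apply/polyP=> n; rewrite coef_tmul coef0 big1 // => i _.
by rewrite coef0 [rescale _ _]raddf0 mulr0.
Qed.

Lemma tmul0l P : tmul 0 P = 0.
Proof.
by apply/polyP=> n; rewrite coef_tmul coef0 big1 // => i _; rewrite coef0 mul0r.
Qed.

Lemma tmul_mono a b m n :
  tmul (a *: 'X^m) (b *: 'X^n) = (a * rescale (r ^+ m) b) *: 'X^(m + n).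
Proof.
apply/polyP=> N; rewrite coef_tmul coefZ coefXn.
have [->|neN] := eqVneq N (m + n)%N.
  have mlt : (m < (m + n).+1)%N by rewrite ltnS leq_addr.
  rewrite (bigD1 (Ordinal mlt)) //= !coefZ !coefXn addKn !eqxx !mulr1.
  rewrite big1 ?addr0 // => i /eqP ne; rewrite coefZ coefXn.
  case: eqP => [e|_]; last by rewrite mulr0 mul0r.
  by case: ne; apply: val_inj.
rewrite mulr0 big1 // => i _; rewrite !coefZ !coefXn.
case: eqP => [e|_]; last by rewrite mulr0 mul0r.
case: eqP => [e'|_]; last by rewrite mulr0 [rescale _ _]raddf0 mulr0.
by case/eqP: neN; rewrite -e -e' subnKC // leq_ord.
Qed.

(** The top degrees add up, since rescaling preserves the degree in [x]. *)
Lemma tmul_lead P Q : r != 0 -> P != 0 -> Q != 0 ->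
  (tmul P Q)`_((size P).-1 + (size Q).-1) != 0.
Proof.
move=> r0 P0 Q0; rewrite coef_tmul.
have mlt : ((size P).-1 < ((size P).-1 + (size Q).-1).+1)%N by rewrite ltnS leq_addr.
rewrite (bigD1 (Ordinal mlt)) //= addKn big1 ?addr0.
  rewrite -!lead_coefE mulf_neq0 ?lead_coef_eq0 //.
  by rewrite rescale_eq0 ?expf_neq0 // lead_coef_eq0.
move=> i ne; have [lt_i|le_i] := ltnP i (size P).
  have {}lt_i : (i < (size P).-1)%N.
    by rewrite ltn_neqAle -val_eqE /= in ne *; rewrite ne -ltnS prednK // size_poly_gt0.
  rewrite (@nth_default _ _ Q) ?[rescale _ _]raddf0 ?mulr0 //.
  have s0 : (0 < size Q)%N by rewrite size_poly_gt0.
  rewrite (leq_trans (leqSpred _)) // ltn_subRL.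
  by rewrite ltn_add2r.
by rewrite (nth_default _ le_i) mul0r.
Qed.

Lemma tmul_eq0 P Q : r != 0 -> tmul P Q = 0 -> P = 0 \/ Q = 0.
Proof.
move=> r0 PQ; have [|P0] := eqVneq P 0; first by left.
have [|Q0] := eqVneq Q 0; first by right.
by have := tmul_lead r0 P0 Q0; rewrite PQ coef0 eqxx.
Qed.

(** Both factors have degree 0 in the outer variable, and then the product of
    their constant coefficients is 1 in the inner polynomial ring. *)
Lemma tmul_eq1 P Q : r != 0 -> tmul P Q = 1 -> exists c : k, P = c%:P%:P.
Proof.
move=> r0 PQ.
have P0 : P != 0.
  by apply/eqP => P0; move/eqP: PQ; rewrite P0 tmul0l eq_sym oner_eq0.
have Q0 : Q != 0.
  by apply/eqP => Q0; move/eqP: PQ; rewrite Q0 tmul0 eq_sym oner_eq0.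
have := tmul_lead r0 P0 Q0; rewrite PQ coef1.
case: (altP (_ =P 0%N)) => [/eqP|]; last by rewrite eqxx.
rewrite addn_eq0 -!subn1 !subn_eq0 => /andP[/size1_polyC eP /size1_polyC eQ] _.
have := congr1 (fun T : {poly {poly k}} => T`_0) PQ.
rewrite coef_tmul big_ord1 subnn coef1 /=.
move/(congr1 (fun p : {poly k} => p \is a GRing.unit)).
rewrite unitrM unitr1 => /andP[+ _]; rewrite poly_unitE => /andP[/eqP s1 _].
by exists P`_0`_0; rewrite {1}eP [in LHS](size1_polyC (eq_leq s1)).
Qed.

Lemma tmul_coef0 P Q : (tmul P Q)`_0 = P`_0 * Q`_0.
Proof.
rewrite coef_tmul big_ord1 subnn expr0 /rescale scale1r.
by rewrite comp_polyXr.
Qed.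

(** Rescaling [x] does not change the value at [x = 0], so the twist disappears
    there. *)
Lemma tmul_horner0 P Q :
  map_poly (horner_eval 0) (tmul P Q) =
  map_poly (horner_eval 0) P * map_poly (horner_eval 0) Q.
Proof.
apply/polyP=> n; rewrite coef_map coef_tmul coefM raddf_sum /=.
apply: eq_bigr => i _; rewrite !coef_map /= /horner_eval hornerM.
by rewrite horner0_rescale.
Qed.

End TwistedProduct.

(** * Normal forms in the quantum plane *)

Section NormalForm.
Variables (k : fieldType) (q : k).
Hypothesis q_neq0 : q != 0.

Local Notation free2 := {malg k[{fmonom 'I_2}]}.
Local Notation lx := (0%R : 'I_2).
Local Notation ly := (1%R : 'I_2).
Local Notation A := (qplane q).
Local Notation x := (qx q).
Local Notation y := (qy q).
Local Notation pi := (\pi_(qplane q) : free2 -> qplane q).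

(** The letters 0 and 1 stand for [x] and [y]; this counts the exchanges
    [y * x -> x * y] that put the word in the order [x ^+ i * y ^+ j]. *)
Fixpoint word_inversions (w : seq 'I_2) : nat :=
  if w is a :: w' then ((a == ly) * count_mem lx w' + word_inversions w')%N
  else 0%N.

Lemma word_inversions_cat w1 w2 : word_inversions (w1 ++ w2) =
  (word_inversions w1 + word_inversions w2 + count_mem ly w1 * count_mem lx w2)%N.
Proof.
elim: w1 => [|a w IH] /=; first by rewrite mul0n addn0.
rewrite IH count_cat mulnDr mulnDl -!addnA; congr (_ + _)%N.
by rewrite addnCA; congr (_ + _)%N; rewrite addnCA.
Qed.

Definition word_nf (w : seq 'I_2) : {poly {poly k}} :=
  (q^-1 ^+ word_inversions w *: 'X^(count_mem lx w)) *: 'X^(count_mem ly w).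

(** Besides the inversions inside each word, every [y] of [w1] must cross every
    [x] of [w2], which is the scalar that [tmul] introduces. *)
Lemma word_nf_cat w1 w2 : word_nf (w1 ++ w2) = tmul q^-1 (word_nf w1) (word_nf w2).
Proof.
rewrite /word_nf tmul_mono rescale_mono word_inversions_cat !count_cat.
rewrite -scalerAl -scalerAr scalerA -exprD -exprM !exprD mulrA.
by congr ((_ *: _) *: _).
Qed.

Definition free_nf : free2 -> {poly {poly k}} :=
  mmap (fun c => c%:P%:P) (fun m : {fmonom 'I_2} => word_nf m).

Fact free_nf_additive : additive free_nf.
Proof. exact: (@mmap_is_additive _ _ _ (polyC \o polyC)). Qed.

HB.instance Definition _ :=
  GRing.isAdditive.Build free2 {poly {poly k}} free_nf free_nf_additive.

Lemma free_nfB : {morph free_nf : u v / u - v}.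
Proof. exact: raddfB. Qed.

Lemma free_nfU c (m : {fmonom 'I_2}) : free_nf << c *g m >> = c%:P *: word_nf m.
Proof.
by rewrite /free_nf (@mmapU _ _ _ (polyC \o polyC)) /= mul_polyC.
Qed.

Lemma tmul_scale (a b : k) P Q :
  tmul q^-1 (a%:P *: P) (b%:P *: Q) = (a * b)%:P *: tmul q^-1 P Q.
Proof.
apply/polyP=> n; rewrite coefZ !coef_tmul mulr_sumr; apply: eq_bigr => i _.
rewrite !coefZ /rescale comp_polyM comp_polyC polyCM -!mulrA.
by congr (_ * _); rewrite mulrCA.
Qed.

Lemma free_nfM u v : free_nf (u * v) = tmul q^-1 (free_nf u) (free_nf v).
Proof.
rewrite malgME raddf_sum /= [in RHS](monalgE u) raddf_sum /=.
rewrite [RHS](big_morph (fun P => tmul q^-1 P _) (tmulDl _ _) (tmul0l _ _)).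
apply: eq_bigr => m _; rewrite raddf_sum /= [in RHS](monalgE v) raddf_sum /=.
rewrite [RHS](big_morph (tmul q^-1 _) (tmulDr _ _) (tmul0 _ _)).
apply: eq_bigr => m' _; rewrite !free_nfU tmul_scale -word_nf_cat.
by rewrite fmM.
Qed.

Lemma free_nfZ c u : free_nf (c *: u) = c%:P *: free_nf u.
Proof.
rewrite [in LHS](monalgE u) [in RHS](monalgE u) (scaler_sumr c) !(raddf_sum free_nf).
rewrite (scaler_sumr c%:P).
apply: eq_bigr => m _ /=; rewrite free_nfU scalerA -polyCM -free_nfU.
by congr free_nf; apply/malgP => m'; rewrite mcoeffZ !mcoeffU mulrnAr.
Qed.

Lemma free_nf_X : free_nf (freeX k) = 'X%:P.
Proof.
by rewrite /freeX free_nfU scale1r fmU /word_nf /= scale1r alg_polyC.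
Qed.

Lemma free_nf_Y : free_nf (freeY k) = 'X.
Proof.
by rewrite /freeY free_nfU scale1r fmU /word_nf /= !scale1r.
Qed.

Lemma tmul_XY : tmul q^-1 'X%:P 'X = 'X%:P * 'X.
Proof.
have -> : 'X%:P = 'X *: 'X^0 :> {poly {poly k}} by rewrite expr0 alg_polyC.
rewrite -[X in tmul _ _ X]scale1r -[X in tmul _ _ (_ *: X)]expr1 tmul_mono.
by rewrite /rescale comp_polyC mulr1 add0n expr1 expr0 alg_polyC mul_polyC.
Qed.

Lemma tmul_YX : tmul q^-1 'X 'X%:P = q^-1%:P *: ('X%:P * 'X).
Proof.
have -> : 'X%:P = 'X *: 'X^0 :> {poly {poly k}} by rewrite expr0 alg_polyC.
rewrite -[X in tmul _ X _]scale1r -[X in tmul _ (_ *: X) _]expr1 tmul_mono.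
rewrite /rescale comp_polyX mul1r addn0 expr0 alg_polyC mul_polyC scalerA.
by rewrite !expr1 mul_polyC.
Qed.

(** Multiplicativity reduces this to the vanishing of the normal form of the
    relation itself. *)
Lemma free_nf_ideal u : u \in qideal q -> free_nf u = 0.
Proof.
move=> /asboolP[s ->]; rewrite raddf_sum big1 // => ab _ /=.
rewrite !free_nfM; suff -> : free_nf (qrel q) = 0 by rewrite tmul0 tmul0l.
have qcommE v w : free_nf (v * w - q *: (w * v)) =
    tmul q^-1 (free_nf v) (free_nf w) - q%:P *: tmul q^-1 (free_nf w) (free_nf v).
  by rewrite free_nfB free_nfZ !free_nfM.
rewrite /qrel qcommE free_nf_X free_nf_Y.
rewrite tmul_XY tmul_YX scalerA -polyCM mulfV // scale1r.
exact: subrr.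
Qed.

Lemma piM u v : pi (u * v) = pi u * pi v.
Proof. exact: pi_qmul. Qed.

(** The coordinates of [a] in the monomials [x ^+ i * y ^+ j]. *)
Definition nf (a : A) : {poly {poly k}} := free_nf (repr a).

Lemma nf_pi u : nf (pi u) = free_nf u.
Proof.
apply/eqP; rewrite -subr_eq0 -free_nfB; apply/eqP/free_nf_ideal => //.
by rewrite -qplane_eq reprK.
Qed.

Lemma nfB : {morph nf : a b / a - b}.
Proof.
move=> a b; have [[u ->] [v ->]] := (qplaneP a, qplaneP b).
by rewrite -[pi u - pi v](raddfB \pi_(qplane q)) !nf_pi free_nfB.
Qed.

HB.instance Definition _ := GRing.isAdditive.Build A {poly {poly k}} nf nfB.

Lemma nf0 : nf 0 = 0.
Proof. exact: raddf0. Qed.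

Lemma nf_sum (I : Type) (r : seq I) (P : pred I) (F : I -> A) :
  nf (\sum_(i <- r | P i) F i) = \sum_(i <- r | P i) nf (F i).
Proof. exact: raddf_sum. Qed.

Lemma nfZ c a : nf (c *: a) = c%:P *: nf a.
Proof.
have [u ->] := qplaneP a.
by rewrite -[c *: pi u](pi_qscale q) !nf_pi free_nfZ.
Qed.

Lemma nfM a b : nf (a * b) = tmul q^-1 (nf a) (nf b).
Proof.
have [[u ->] [v ->]] := (qplaneP a, qplaneP b).
by rewrite -[pi u * pi v](pi_qmul q) !nf_pi free_nfM.
Qed.

Lemma nf_x : nf x = 'X%:P.
Proof. by rewrite /qx nf_pi free_nf_X. Qed.

Lemma nf_y : nf y = 'X.
Proof. by rewrite /qy nf_pi free_nf_Y. Qed.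

Lemma nf1 : nf 1 = 1.
Proof.
have -> : 1 = pi << (1 : k) *g (mone : {fmonom 'I_2}) >> :> A by exact: (esym (pi_qone q)).
rewrite nf_pi free_nfU fm1.
by rewrite /word_nf /= !scale1r.
Qed.

(** Horner evaluation in the noncommutative quantum plane puts the coefficients,
    which are polynomials in [x], to the left of the powers of [y]. *)
Definition unnf (P : {poly {poly k}}) : A := (map_poly (horner_alg x) P).[y].

Lemma unnfB : {morph unnf : P Q / P - Q}.
Proof. by move=> P Q; rewrite /unnf raddfB /= hornerD hornerN. Qed.

HB.instance Definition _ := GRing.isAdditive.Build {poly {poly k}} A unnf unnfB.

Lemma unnfMy P : unnf (P * 'X) = unnf P * y.
Proof. by rewrite /unnf rmorphM /= map_polyX hornerMX. Qed.

Lemma unnfMx P : unnf ('X%:P * P) = x * unnf P.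
Proof.
by rewrite /unnf rmorphM /= map_polyC hornerCM /= horner_algX.
Qed.

Lemma unnfZ c P : unnf (c%:P *: P) = c *: unnf P.
Proof.
rewrite -mul_polyC /unnf rmorphM /= map_polyC hornerCM /= horner_algC.
by rewrite mulr_algl.
Qed.

Lemma unnf1 : unnf 1 = 1.
Proof. by rewrite /unnf rmorph1 hornerC. Qed.

Lemma unnf_mono c i j : unnf ((c *: 'X^i) *: 'X^j) = c *: (x ^+ i * y ^+ j).
Proof.
rewrite -!mul_polyC polyCM -mulrA mul_polyC unnfZ.
congr (_ *: _); elim: j => [|j IH]; last by rewrite !exprSr !mulrA unnfMy IH.
rewrite !expr0 !mulr1; elim: i => [|i IH]; first by rewrite expr0 unnf1.
by rewrite !exprS polyCM unnfMx IH.
Qed.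

Lemma y_mul_xn i : y * x ^+ i = (q^-1 ^+ i) *: (x ^+ i * y).
Proof.
have yx : y * x = q^-1 *: (x * y).
  by rewrite qx_qy scalerA mulVf // scale1r.
elim: i => [|i IH]; first by rewrite !expr0 scale1r mul1r mulr1.
rewrite [in LHS]exprSr mulrA IH -scalerAl -[in LHS]mulrA yx -scalerAr scalerA.
by rewrite -exprSr mulrA -exprSr.
Qed.

Lemma pi_word (w : seq 'I_2) : pi << (1 : k) *g FMonom w >> = unnf (word_nf w).
Proof.
rewrite unnf_mono; elim: w => [|a w IH] /=.
  by rewrite !expr0 mulr1 scale1r -fmoneE; exact: pi_qone.
have -> : << (1 : k) *g FMonom (a :: w) >> =
    << (1 : k) *g fmu a >> * << (1 : k) *g FMonom w >> :> free2.
  have -> : FMonom (a :: w) = mmul (fmu a) (FMonom w).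
    by apply/eqP; rewrite fmP fmM fmU.
  by rewrite malgM_def fgmulUU mulr1.
rewrite piM IH.
case: (eqVneq a lx) => [->|a0].
  by rewrite mul0n add0n add0n exprS -[pi _]/x -scalerAr mulrA.
have -> : a = ly.
  by apply/val_inj; case: a a0 => -[|[|]].
rewrite -[pi _]/y eqxx mul1n add0n -scalerAr mulrA y_mul_xn -scalerAl scalerA.
by rewrite -exprD addnC -mulrA -exprS.
Qed.

(** The monomials span: by additivity it is enough to look at a word, where the
    commutation rule produces the normal form ([pi_word]). *)
Lemma nfK : cancel nf unnf.
Proof.
move=> a; have [u ->] := qplaneP a; rewrite nf_pi (monalgE u).
rewrite (raddf_sum free_nf) (raddf_sum unnf) (raddf_sum \pi_(qplane q)) /=.
apply: eq_bigr => m _; rewrite free_nfU unnfZ.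
have -> : word_nf m = word_nf (FMonom m) by [].
rewrite -pi_word fmK -[RHS]/(pi _).
have -> : << u@_m *g m >> = u@_m *: << (1 : k) *g m >> :> free2.
  by apply/malgP => m'; rewrite mcoeffZ !mcoeffU mulrnAr mulr1.
by rewrite (pi_qscale q).
Qed.

Lemma nf_mono i j : nf (x ^+ i * y ^+ j) = 'X^i *: 'X^j.
Proof.
have nfx : nf (x ^+ i) = 'X^i *: 'X^0.
  elim: i => [|i IH]; first by rewrite !expr0 nf1 scale1r.
  rewrite exprS nfM IH nf_x -['X%:P]mulr1 mul_polyC -(expr0 'X) tmul_mono.
  rewrite -[X in rescale _ X]scale1r rescale_mono expr0 expr1n mulr1 scale1r.
  by rewrite -exprS.
elim: j => [|j IH]; first by rewrite expr0 mulr1.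
rewrite exprSr mulrA nfM IH nf_y -[X in tmul _ _ X]scale1r.
rewrite -[X in tmul _ _ (_ *: X)]expr1 tmul_mono.
by rewrite /rescale comp_polyC mulr1 addn1.
Qed.

Lemma nf_inj : injective nf.
Proof. exact: can_inj nfK. Qed.

Lemma qplane_domain (a b : A) : a * b = 0 -> a = 0 \/ b = 0.
Proof.
have q'0 : q^-1 != 0 by rewrite invr_eq0.
move/(congr1 nf); rewrite nfM (raddf0 nf) => /(tmul_eq0 q'0)[] h; [left|right].
  by apply: nf_inj; rewrite h raddf0.
by apply: nf_inj; rewrite h raddf0.
Qed.

Lemma qplane_unit (a b : A) : a * b = 1 -> exists c : k, a = c%:A.
Proof.
have q'0 : q^-1 != 0 by rewrite invr_eq0.
move/(congr1 nf); rewrite nfM nf1 => /(tmul_eq1 q'0)[c e]; exists c.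
by apply: nf_inj; rewrite e nfZ nf1 alg_polyC.
Qed.

(** [x] and [y] generate the quantum plane as an algebra. *)
Lemma qplane_ind (T : A -> Prop) :
  T 1 -> T x -> T y -> (forall c a b, T a -> T b -> T (c *: a + b)) ->
  (forall a b, T a -> T b -> T (a * b)) -> forall a, T a.
Proof.
move=> T1 Tx Ty TL TM a.
have T0 : T 0 by have := TL (-1) _ _ T1 T1; rewrite scaleN1r addNr.
have TX b n : T b -> T (b ^+ n).
  by move=> Tb; elim: n => [|n IH]; rewrite ?expr0 // exprS; apply: TM.
rewrite -(nfK a) /unnf horner_coef.
elim/big_ind: _ => // [u v Tu Tv|j _]; first by rewrite -[u]scale1r; apply: TL.
apply: TM; last exact: TX.
rewrite coef_map /=; set p := (nf a)`_j.
rewrite /horner_alg /horner_morph horner_coef.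
elim/big_ind: _ => // [u v Tu Tv|i _]; first by rewrite -[u]scale1r; apply: TL.
rewrite coef_map /= mulr_algl -[_ *: _]addr0; apply: TL => //; exact: TX.
Qed.

(** Setting [x = 0] in the normal form is the reduction modulo the ideal of
    [x]: each coefficient [p(x)] with [p(0) = 0] has [x] as a left factor. *)
Lemma nf_ker_x (a : A) : map_poly (horner_eval 0) (nf a) = 0 -> exists b, a = x * b.
Proof.
move=> h; pose Q := map_poly (fun p : {poly k} => p %/ 'X) (nf a).
exists (unnf Q); rewrite -unnfMx -[LHS]nfK; congr unnf.
apply/polyP=> j; rewrite coefCM coef_map_id0 ?div0p // mulrC divpK //.
have /(congr1 (fun p : {poly k} => p`_j)) := h.
rewrite coef_map coef0 /= => /eqP; rewrite -/(root _ _) -dvdp_XsubCl.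
by rewrite subr0.
Qed.

(** Setting [y = 0] is the reduction modulo the ideal of [y], which comes out
    as a right factor because the powers of [y] stand on the right. *)
Lemma nf_ker_y (a : A) : (nf a)`_0 = 0 -> exists b, a = b * y.
Proof.
move=> h; exists (unnf (drop_poly 1 (nf a))); rewrite -unnfMy -[LHS]nfK.
congr unnf; apply/polyP=> -[|j]; rewrite coefMX //=.
by rewrite coef_drop_poly addn1.
Qed.
End NormalForm.

(** * Automorphisms of the quantum plane are diagonal *)

Section Automorphisms.
Variables (k : fieldType) (A : algType k) (f : alg_aut A).

Lemma alg_autM : {morph f : a b / a * b}.
Proof. exact: (alg_aut_monoid f).2. Qed.

Lemma alg_aut1 : f 1 = 1.
Proof. exact: (alg_aut_monoid f).1. Qed.

Lemma alg_aut0 : f 0 = 0.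
Proof.
by have := alg_aut_linear f (-1) 0 0; rewrite !scaleN1r !addNr.
Qed.

Lemma alg_autZ c a : f (c *: a) = c *: f a.
Proof. by have := alg_aut_linear f c a 0; rewrite alg_aut0 !addr0. Qed.

Lemma alg_autD : {morph f : a b / a + b}.
Proof. by move=> a b; have := alg_aut_linear f 1 a b; rewrite !scale1r. Qed.

Lemma alg_autX a n : f (a ^+ n) = f a ^+ n.
Proof. by elim: n => [|n IH]; rewrite ?expr0 ?alg_aut1 // !exprS alg_autM IH. Qed.
End Automorphisms.

Section QPlaneAut.
Variables (k : fieldType) (q : k).
Hypotheses (q_neq0 : q != 0) (q_neq1 : q != 1) (q2_neq1 : q ^+ 2 != 1).
Local Notation A := (qplane q).
Local Notation x := (qx q).
Local Notation y := (qy q).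

(** The quotient map onto the quotient by the ideal of [x], a polynomial ring
    in [y]; dually [mod_y] maps onto polynomials in [x]. *)
Definition mod_x (a : A) : {poly k} := map_poly (horner_eval 0) (nf a).
Definition mod_y (a : A) : {poly k} := (nf a)`_0.

Lemma mod_xM : {morph mod_x : a b / a * b}.
Proof. by move=> a b; rewrite /mod_x nfM // tmul_horner0. Qed.

Lemma mod_yM : {morph mod_y : a b / a * b}.
Proof. by move=> a b; rewrite /mod_y nfM // tmul_coef0. Qed.

Lemma mod_xZ c a : mod_x (c *: a) = c *: mod_x a.
Proof.
apply/polyP=> n; rewrite /mod_x nfZ // coefZ !coef_map coefZ /= /horner_eval.
exact: hornerCM.
Qed.

Lemma mod_yZ c a : mod_y (c *: a) = c *: mod_y a.
Proof. by rewrite /mod_y nfZ // coefZ mul_polyC. Qed.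

Lemma mod_x_y : mod_x y = 'X.
Proof. by rewrite /mod_x nf_y // map_polyX. Qed.

Lemma mod_y_x : mod_y x = 'X.
Proof. by rewrite /mod_y nf_x // coefC. Qed.

Lemma qx_neq0 : x != 0.
Proof.
apply/eqP=> /(congr1 mod_y)/eqP.
by rewrite mod_y_x /mod_y nf0 // coef0 polyX_eq0.
Qed.

Lemma qy_neq0 : y != 0.
Proof.
apply/eqP=> /(congr1 mod_x)/eqP.
by rewrite mod_x_y /mod_x nf0 // raddf0 polyX_eq0.
Qed.

Lemma qplane_mulIr (c a b : A) : c != 0 -> a * c = b * c -> a = b.
Proof.
move=> c0 /eqP; rewrite -subr_eq0 -mulrBl => /eqP/(qplane_domain q_neq0)[]; last first.
  by move=> e; rewrite e eqxx in c0.
by move/eqP; rewrite subr_eq0 => /eqP.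
Qed.

(** This turns the right ideal generated by [x] into a left one, so that
    factors can be cancelled on the same side for [x] and for [y]. *)
Lemma qx_normal (b : A) : exists b', x * b = b' * x.
Proof.
elim/(qplane_ind q_neq0): b => [||| c a b [a' ea] [b' eb] | a b [a' ea] [b' eb]].
- by exists 1; rewrite mulr1 mul1r.
- by exists x.
- by exists (q *: y); rewrite qx_qy scalerAl.
- by exists (c *: a' + b'); rewrite mulrDr mulrDl -scalerAr -scalerAl ea eb.
- by exists (a' * b'); rewrite mulrA ea -mulrA eb mulrA.
Qed.

Lemma mod_x_ker (a : A) : mod_x a = 0 -> exists b, a = b * x.
Proof. by move=> /(nf_ker_x q_neq0)[b ->]; apply: qx_normal. Qed.

Lemma mod_y_ker (a : A) : mod_y a = 0 -> exists b, a = b * y.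
Proof. exact: (nf_ker_y q_neq0). Qed.

Lemma qplane_aut_eq (f g : alg_aut A) : f x = g x -> f y = g y -> f = g.
Proof.
move=> ex ey; apply: alg_autP; elim/(qplane_ind q_neq0) => //.
- by rewrite !alg_aut1.
- by move=> c a b ea eb; rewrite !alg_aut_linear ea eb.
- by move=> a b ea eb; rewrite !alg_autM ea eb.
Qed.

Lemma aut_qcomm (f : alg_aut A) : f x * f y = q *: (f y * f x).
Proof. by rewrite -!alg_autM qx_qy alg_autZ. Qed.

(** The target is a commutative domain, where the relation between [f x] and
    [f y] becomes [(1 - q) * (h (f x) * h (f y)) = 0]. *)
Lemma aut_kills_generator (h : A -> {poly k}) (f : alg_aut A) :
  {morph h : a b / a * b} -> (forall c a, h (c *: a) = c *: h a) ->
  h (f x) = 0 \/ h (f y) = 0.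
Proof.
move=> hM hZ; have /(congr1 h)/eqP := aut_qcomm f.
rewrite hZ !hM [h (f y) * _]mulrC -subr_eq0 -{1}[_ * _]scale1r -scalerBl.
rewrite scaler_eq0 subr_eq0 eq_sym (negPf q_neq1) mulf_eq0 /=.
by case/orP=> /eqP; [left|right].
Qed.

(** Here [u] and [v] are to be the generators.  From
    [u = f (b * v) = f b * a * u] the factors [f b] and [a] are units, hence
    scalars. *)
Lemma aut_scale_of_mul (f : alg_aut A) (u v a b : A) : u != 0 ->
  f v = a * u -> alg_aut_inv f u = b * v -> exists2 c, c != 0 & f v = c *: u.
Proof.
move=> u0 fv gu; have fba : f b * a = 1.
  apply: (qplane_mulIr u0).
  by rewrite mul1r -mulrA -fv -alg_autM -gu alg_aut_invK.
have [c fb] := qplane_unit q_neq0 fba.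
move: fba; rewrite fb mulr_algl => ca.
have c0 : c != 0.
  by apply/eqP=> c0; move/eqP: ca; rewrite c0 scale0r eq_sym oner_eq0.
exists c^-1; first by rewrite invr_eq0.
by rewrite fv -[a](scalerK c0) ca mulr_algl.
Qed.

(** The inverse of [f] must also send a generator into the ideal of [x]; if it
    were [y], then [y] itself would lie in the ideal of [x]. *)
Lemma aut_scales_x (f : alg_aut A) : mod_x (f x) = 0 ->
  exists2 c, c != 0 & f x = c *: x.
Proof.
move=> fx; have [a ea] := mod_x_ker fx.
have [gx|gy] := aut_kills_generator (alg_aut_inv f) mod_xM mod_xZ.
  by have [b eb] := mod_x_ker gx; apply: aut_scale_of_mul qx_neq0 ea eb.
have [b eb] := mod_x_ker gy.
have : mod_x (f (alg_aut_inv f y)) = 0 by rewrite eb alg_autM mod_xM fx mulr0.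
by rewrite alg_aut_invK mod_x_y => /eqP; rewrite polyX_eq0.
Qed.

Lemma aut_scales_y (f : alg_aut A) : mod_y (f y) = 0 ->
  exists2 c, c != 0 & f y = c *: y.
Proof.
move=> fy; have [a ea] := mod_y_ker fy.
have [gx|gy] := aut_kills_generator (alg_aut_inv f) mod_yM mod_yZ; last first.
  by have [b eb] := mod_y_ker gy; apply: aut_scale_of_mul qy_neq0 ea eb.
have [b eb] := mod_y_ker gx.
have : mod_y (f (alg_aut_inv f x)) = 0 by rewrite eb alg_autM mod_yM fy mulr0.
by rewrite alg_aut_invK mod_y_x => /eqP; rewrite polyX_eq0.
Qed.

Lemma aut_y_mod_xy_neq0 (f : alg_aut A) : mod_x (f y) = 0 -> mod_y (f y) = 0 -> False.
Proof.
move=> fyx /aut_scales_y[c c0 fy]; move/eqP: fyx.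
by rewrite fy mod_xZ mod_x_y scaler_eq0 (negPf c0) polyX_eq0.
Qed.

Lemma aut_swap_false (f : alg_aut A) c d :
  c != 0 -> d != 0 -> f x = c *: y -> f y = d *: x -> False.
Proof.
move=> c0 d0 fx fy; have := aut_qcomm f; rewrite fx fy -!scalerAl -!scalerAr.
rewrite !scalerA qx_qy scalerA => /eqP; rewrite -subr_eq0 -scalerBl scaler_eq0.
have -> : c * d - q * d * c * q = c * d * (1 - q ^+ 2).
  by ring.
rewrite !mulf_eq0 (negPf c0) (negPf d0) subr_eq0 eq_sym (negPf q2_neq1) /=.
move/eqP=> yx; have [] := qplane_domain q_neq0 yx => /eqP.
  by rewrite (negPf qy_neq0).
by rewrite (negPf qx_neq0).
Qed.

(** If [f x] lies in the ideal of [x] then [f] scales [x], hence does not kill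
    it modulo [y], and so scales [y] too.  Otherwise [f y] lies in the ideal of
    [x] and [f x] in that of [y], and the same holds for the inverse of [f];
    then [f] exchanges [x] and [y] up to scalars, which [aut_swap_false]
    excludes. *)
Lemma qplane_aut_diag (f : alg_aut A) :
  exists c d, [/\ c != 0, d != 0, f x = c *: x & f y = d *: y].
Proof.
have [fx|fyx] := aut_kills_generator f mod_xM mod_xZ.
  have [c c0 ec] := aut_scales_x fx.
  have [fxy|fy] := aut_kills_generator f mod_yM mod_yZ.
    move/eqP: fxy.
    by rewrite ec mod_yZ mod_y_x scaler_eq0 (negPf c0) polyX_eq0.
  by have [d d0 ed] := aut_scales_y fy; exists c, d.
have [fxy|fyy] := aut_kills_generator f mod_yM mod_yZ; last first.
  by case: (aut_y_mod_xy_neq0 fyx fyy).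
set g := alg_aut_inv f.
have [gx|gyx] := aut_kills_generator g mod_xM mod_xZ.
  have [c c0 ec] := aut_scales_x gx.
  have fx : c *: f x = x by rewrite -alg_autZ -ec alg_aut_invK.
  move/(congr1 mod_y)/eqP: fx.
  by rewrite mod_yZ fxy scaler0 mod_y_x eq_sym polyX_eq0.
have [gxy|gyy] := aut_kills_generator g mod_yM mod_yZ; last first.
  by case: (aut_y_mod_xy_neq0 gyx gyy).
have [[a ea] [b eb]] := (mod_y_ker fxy, mod_x_ker fyx).
have [[a' ea'] [b' eb']] := (mod_y_ker gxy, mod_x_ker gyx).
have [c c0 ec] := aut_scale_of_mul qy_neq0 ea eb'.
have [d d0 ed] := aut_scale_of_mul qx_neq0 eb ea'.
by case: (aut_swap_false c0 d0 ec ed).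
Qed.

(** As [f x] is a multiple of [x], its coefficient at [x] is the eigenvalue. *)
Definition eigen_x (f : alg_aut A) : k := (mod_y (f x))`_1.
Definition eigen_y (f : alg_aut A) : k := (mod_x (f y))`_1.

Lemma eigen_xE (f : alg_aut A) : f x = eigen_x f *: x.
Proof.
have [c [d [_ _ e _]]] := qplane_aut_diag f.
by rewrite /eigen_x e mod_yZ mod_y_x coefZ coefX mulr1.
Qed.

Lemma eigen_yE (f : alg_aut A) : f y = eigen_y f *: y.
Proof.
have [c [d [_ _ _ e]]] := qplane_aut_diag f.
by rewrite /eigen_y e mod_xZ mod_x_y coefZ coefX mulr1.
Qed.

Lemma scale_qx_inj : injective (fun c => c *: x).
Proof.
move=> a b /(congr1 mod_y); rewrite !mod_yZ mod_y_x.
by move/(congr1 (fun p : {poly k} => p`_1)); rewrite !coefZ coefX !mulr1.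
Qed.

Lemma scale_qy_inj : injective (fun c => c *: y).
Proof.
move=> a b /(congr1 mod_x); rewrite !mod_xZ mod_x_y.
by move/(congr1 (fun p : {poly k} => p`_1)); rewrite !coefZ coefX !mulr1.
Qed.

Lemma eigen_x_character : is_character eigen_x.
Proof.
split=> [f g|f]; last first.
  have [c [d [c0 _ e _]]] := qplane_aut_diag f.
  by move: e; rewrite eigen_xE => /scale_qx_inj ->.
apply: scale_qx_inj; rewrite /= -eigen_xE.
by rewrite -[LHS]/(f (g x)) eigen_xE alg_autZ eigen_xE scalerA mulrC.
Qed.

Lemma eigen_y_character : is_character eigen_y.
Proof.
split=> [f g|f]; last first.
  have [c [d [_ d0 _ e]]] := qplane_aut_diag f.
  by move: e; rewrite eigen_yE => /scale_qy_inj ->.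
apply: scale_qy_inj; rewrite /= -eigen_yE.
by rewrite -[LHS]/(f (g y)) eigen_yE alg_autZ eigen_yE scalerA mulrC.
Qed.

Lemma aut_faithful (f : alg_aut A) : eigen_x f = 1 -> eigen_y f = 1 -> f = 1%g.
Proof.
move=> fx fy; apply: qplane_aut_eq; first by rewrite eigen_xE fx scale1r.
by rewrite eigen_yE fy scale1r.
Qed.

Lemma aut_mono (f : alg_aut A) i j :
  f (x ^+ i * y ^+ j) = (eigen_x f ^+ i * eigen_y f ^+ j) *: (x ^+ i * y ^+ j).
Proof.
rewrite alg_autM !alg_autX eigen_xE eigen_yE !exprZn.
by rewrite -scalerAl -scalerAr scalerA.
Qed.

Lemma qplane_aut_comm (f g : alg_aut A) : (f * g)%g = (g * f)%g.
Proof.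
apply: qplane_aut_eq.
  rewrite -[LHS]/(f (g x)) -[RHS]/(g (f x)) (eigen_xE g) alg_autZ (eigen_xE f).
  by rewrite alg_autZ (eigen_xE g) !scalerA mulrC.
rewrite -[LHS]/(f (g y)) -[RHS]/(g (f y)) (eigen_yE g) alg_autZ (eigen_yE f).
by rewrite alg_autZ (eigen_yE g) !scalerA mulrC.
Qed.
End QPlaneAut.

(** * Inner skew derivations and their isotropy *)

Section InnerDerivations.
Variables (k : fieldType) (A : algType k) (sigma : alg_aut A) (w : A).

Definition inner_derivation (a : A) : A := w * sigma a - a * w.

Lemma inner_sigma_derivation : sigma_derivation sigma inner_derivation.
Proof.
split=> [c a b|a b]; rewrite /inner_derivation.
  rewrite alg_aut_linear mulrDr mulrDl scalerBr opprD -scalerAr -scalerAl.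
  by rewrite addrACA.
by rewrite alg_autM mulrBl mulrBr !mulrA addrA subrK.
Qed.

(** As [f] commutes with [sigma], it conjugates the derivation attached to [w]
    into the one attached to [f w]; the two agree when their difference, which
    is attached to [f w - w], vanishes. *)
Lemma inner_isotropyP (f : alg_aut A) : f \o sigma = sigma \o f ->
  isotropy sigma inner_derivation f <->
  forall a, (f w - w) * sigma a = a * (f w - w).
Proof.
move=> fs; have fsE a : f (sigma a) = sigma (f a) by have /= := congr1 (@^~ a) fs.
have fB : {morph f : a b / a - b}.
  by move=> a b; rewrite alg_autD -[- b]scaleN1r alg_autZ scaleN1r.
have eqE b : (f w * sigma b - b * f w == w * sigma b - b * w) =
    ((f w - w) * sigma b == b * (f w - w)).
  rewrite -subr_eq0 -[RHS]subr_eq0 mulrBl mulrBr !opprB addrACA [in RHS]addrACA.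
  by congr (_ + _ == 0); apply: addrC.
split=> [[_ fd] a|fw]; last first.
  split=> //; apply/funext => a /=; rewrite /inner_derivation fB !alg_autM fsE.
  by apply/eqP; rewrite eqE fw.
apply/eqP; rewrite -eqE; apply/eqP; have /= := congr1 (@^~ (alg_aut_inv f a)) fd.
by rewrite /inner_derivation fB !alg_autM fsE alg_aut_invK.
Qed.
End InnerDerivations.

Section Monomials.
Variables (k : fieldType) (q : k).
Hypothesis q_neq0 : q != 0.
Local Notation A := (qplane q).
Local Notation x := (qx q).
Local Notation y := (qy q).

(** Linear independence of the monomials in a rectangle of exponents with
    corner [(a, b)]. *)
Lemma qmono_free (a b m n : nat) (d : 'I_m -> 'I_n -> k) :
  \sum_i \sum_j d i j *: (x ^+ (a + i) * y ^+ (b + j)) = 0 ->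
  forall i j, d i j = 0.
Proof.
move/(congr1 (@nf k q)); rewrite nf0 // nf_sum // => e i0 j0.
have := congr1 (fun P : {poly {poly k}} => P`_(b + j0)`_(a + i0)) e.
rewrite !coef0 => <-; rewrite coef_sum coef_sum (bigD1 i0) //= [X in _ + X]big1.
  rewrite addr0 nf_sum // !coef_sum (bigD1 j0) //= big1.
    rewrite addr0 nfZ // nf_mono // !coefZ coefXn eqxx mulr1 coefCM coefXn.
    by rewrite eqxx mulr1.
  move=> j ne; rewrite nfZ // nf_mono // !coefZ coefXn eqn_add2l.
  by rewrite eq_sym val_eqE (negPf ne) !mulr0 coef0.
move=> i ne; rewrite nf_sum // !coef_sum big1 // => j _.
rewrite nfZ // nf_mono // !coefZ coefCM coefXn mulr_natr coefMn coefXn eqn_add2l.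
by rewrite [_ == _ :> nat]eq_sym val_eqE (negPf ne) mul0rn mulr0.
Qed.

Lemma qmono_mulx i j :
  x ^+ i * y ^+ j * x = (q^-1 ^+ j) *: (x ^+ i.+1 * y ^+ j).
Proof.
have yx n : y ^+ n * x = q^-1 ^+ n *: (x * y ^+ n).
  elim: n => [|n IH]; first by rewrite !expr0 mul1r mulr1 scale1r.
  rewrite [in LHS]exprS -mulrA IH -scalerAr mulrA -[X in y * X]expr1.
  by rewrite y_mul_xn // !expr1 -scalerAl scalerA -exprSr -mulrA -exprS.
by rewrite -mulrA yx -scalerAr mulrA exprSr.
Qed.
End Monomials.

(** The powers of [q] are distinct, so [alpha] is at most one of them.  The bound
    is a multiple of [n.+1] because the exponents will be shifted by a multiple
    of the order of a group. *)
Lemma exp_eventually_neq (k : fieldType) (q alpha : k) (n : nat) : q != 0 ->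
  (forall m, (0 < m)%N -> q ^+ m != 1) ->
  exists M, forall j, (M * n.+1 <= j)%N -> q ^+ j != alpha.
Proof.
move=> q0 qN.
have [[m em]|no] := pselect (exists m, q ^+ m = alpha); last first.
  by exists 0%N => j _; apply/eqP=> e; apply: no; exists j.
exists m.+1 => j lej; have lmj : (m < j)%N.
  by apply: leq_trans lej; rewrite leq_pmulr.
apply/eqP=> ej; have := qN (j - m)%N; rewrite subn_gt0 lmj => /(_ isT)/eqP; apply.
by apply: (mulfI (expf_neq0 m q0)); rewrite -exprD subnKC ?(ltnW lmj) // mulr1 ej em.
Qed.

Section Isotropy.
Variables (k : fieldType) (q : k).
Hypotheses (k_char0 : [pchar k] =i pred0) (q_neq0 : q != 0).
Hypothesis q_order : forall m, (0 < m)%N -> q ^+ m != 1.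
Local Notation A := (qplane q).
Local Notation x := (qx q).
Local Notation y := (qy q).

Definition weight (f : alg_aut A) i j : k := eigen_x f ^+ i * eigen_y f ^+ j.

(** The element [w] is the sum of the monomials [x ^+ (M + i) * y ^+ (M + j)],
    [i, j <= size s], for which [weight _ i j] is trivial on [s].  The shift by
    [M] pushes all of them beyond the exponents of [y] where a monomial could
    occur in [u = f w - w] with [u * sigma x = x * u]. *)
Lemma isotropy_inner_eq (alpha : k) (sigma : alg_aut A) (s : seq (alg_aut A)) :
  sigma x = alpha *: x ->
  uniq s -> 1%g \in s ->
  (forall g h, g \in s -> h \in s -> (g * h)%g \in s) ->
  (forall g, g \in s -> g^-1%g \in s) ->
  exists w, forall f, isotropy sigma (inner_derivation sigma w) f <-> f \in s.
Proof.
move=> sx us s1 sM sV.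
have q1 : q != 1 by rewrite -[q]expr1 q_order.
have q2 : q ^+ 2 != 1 by rewrite q_order.
have cxP := eigen_x_character q_neq0 q1 q2.
have cyP := eigen_y_character q_neq0 q1 q2.
have [N0 es] : exists n, size s = n.+1 by case: (s) s1 => // a t _; exists (size t).
have [m aM] := exp_eventually_neq alpha N0 q_neq0 q_order.
set n := size s; set M := (m * n)%N; rewrite -es -/n -/M in aM.
pose L i j := all (fun h => weight h i j == 1) s.
pose w : A := \sum_(i < n.+1) \sum_(j < n.+1)
  (L i j)%:R *: (x ^+ (M + i) * y ^+ (M + j)).
have weightM f i j : weight f (M + i) (M + j) = weight f M M * weight f i j.
  by rewrite /weight !exprD mulrACA.
have weightMM h : h \in s -> weight h M M = 1.
  move=> hs; rewrite /weight /M !(mulnC m) !exprM.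
  by rewrite !(character_expn_size (s := s)) // !expr1n mulr1.
have fwE (f : alg_aut A) : f w - w = \sum_(i < n.+1) \sum_(j < n.+1)
    ((L i j)%:R * (weight f (M + i) (M + j) - 1)) *: (x ^+ (M + i) * y ^+ (M + j)).
  rewrite (big_morph f (alg_autD f) (alg_aut0 f)) -sumrB; apply: eq_bigr => i _.
  rewrite (big_morph f (alg_autD f) (alg_aut0 f)) -sumrB; apply: eq_bigr => j _.
  by rewrite alg_autZ aut_mono // scalerA -scalerBl mulrBr mulr1.
exists w => f.
have fs : f \o sigma = sigma \o f.
  apply/funext => a.
  exact: (congr1 (fun g : alg_aut A => g a) (qplane_aut_comm q_neq0 q1 q2 f sigma)).
rewrite (inner_isotropyP w fs); split=> [fw|fs']; last first.
  move=> a; rewrite fwE big1 ?mul0r ?mulr0 // => i _; rewrite big1 // => j _.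
  have [/allP Lij|_] := boolP (L i j); last by rewrite mul0r scale0r.
  by rewrite weightM weightMM // mul1r (eqP (Lij _ fs')) subrr mulr0 scale0r.
have {fw} := fw x; rewrite sx -scalerAr => /eqP; rewrite -subr_eq0 => /eqP fw.
(* Coefficient of [x ^+ (M + i).+1 * y ^+ (M + j)] in
   [u * sigma x - x * u]; its factor [alpha * q ^- (M + j) - 1] is nonzero. *)
have coefs0 (i j : 'I_n.+1) : L i j -> weight f (M + i) (M + j) = 1.
  move=> Lij.
  pose d (i j : 'I_n.+1) := (alpha * q^-1 ^+ (M + j) - 1) *
     ((L i j)%:R * (weight f (M + i) (M + j) - 1)).
  have : d i j = 0.
    apply: (qmono_free (a := M.+1) (b := M) q_neq0); rewrite -[RHS]fw fwE.
    rewrite mulr_suml mulr_sumr scaler_sumr -sumrB; apply: eq_bigr => i' _.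
    rewrite mulr_suml mulr_sumr scaler_sumr -sumrB; apply: eq_bigr => j' _.
    rewrite -scalerAl qmono_mulx // -scalerAr mulrA -exprS !scalerA -scalerBl.
    rewrite /d; move: (_ * (weight _ _ _ - 1)) (q^-1 ^+ _) => c t.
    have -> : (alpha * t - 1) * c = alpha * c * t - c by ring.
    by rewrite addSn.
  move/eqP; rewrite /d Lij mul1r mulf_eq0 !subr_eq0 => /orP[|/eqP //].
  rewrite exprVn -[1](mulfV (expf_neq0 (M + j) q_neq0)).
  rewrite (inj_eq (mulIf _)) ?invr_eq0 ?expf_neq0 // eq_sym.
  by rewrite (negPf (aM _ _)) // leq_addr.
apply: (mem_of_trivial_characters k_char0 cxP cyP) => //.
  exact: aut_faithful.
move=> i j lei lej Lij.
have LL : L i j by apply/allP=> h /Lij /eqP.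
have L0 : L 0 0 by apply/allP=> h _; rewrite /weight !expr0 mulr1.
(* The case [i = j = 0] removes the shift by [M] from the others. *)
have wM : weight f M M = 1.
  by have := coefs0 ord0 ord0 L0; rewrite /= !addn0.
have := coefs0 (Ordinal (lei : (i < n.+1)%N)) (Ordinal (lej : (j < n.+1)%N)) LL.
by rewrite weightM wM mul1r.
Qed.
End Isotropy.

Theorem proposition11 (k : closedFieldType) (k_char0 : [pchar k] =i pred0)
    (q : k) (q_neq0 : q != 0)
    (q_not_root_of_unity : forall n : nat, (0 < n)%N -> q ^+ n != 1)
    (alpha beta : k) (alpha_neq0 : alpha != 0) (beta_neq0 : beta != 0)
    (sigma : alg_aut (qplane q))
    (sigma_x : sigma (qx q) = alpha *: qx q)
    (sigma_y : sigma (qy q) = beta *: qy q)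
    (H : set (alg_aut (qplane q)))
    (H_subgroup : is_subgroup H) (H_finite : finite_set H) :
  exists delta : qplane q -> qplane q,
    sigma_derivation sigma delta /\ subgroups_isog (isotropy sigma delta) H.
Proof.
case: H_subgroup => H1 HM HV.
have /finite_seqP[s0 Hs0] := H_finite.
pose s := undup s0.
have Hs f : H f <-> f \in s by rewrite mem_undup Hs0.
have sM g h : g \in s -> h \in s -> (g * h)%g \in s.
  by move=> /Hs Hg /Hs Hh; apply/Hs; apply: HM.
have sV g : g \in s -> g^-1%g \in s by move=> /Hs Hg; apply/Hs; apply: HV.
have s1 : 1%g \in s by apply/Hs.
have [w wP] := isotropy_inner_eq k_char0 q_neq0 q_not_root_of_unity sigma_x
  (undup_uniq s0) s1 sM sV.
exists (inner_derivation sigma w); split; first exact: inner_sigma_derivation.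
exists id; split=> //; split=> [f /wP/Hs//|f g _ _ //|f /Hs/wP Hf].
by exists f.
Qed.
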